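(* Suppose $\mathcal{U}$ and $\mathcal{U}'$ are non-principal ultrafilters on $\omega$ such that both $\mathrm{cf}(\mathcal{U}\text{-prod}\,\omega)<\mathfrak{s}$ and $\mathrm{cf}(\mathcal{U}'\text{-prod}\,\omega)<\mathfrak{s}$. Then $\mathcal{U}$ and $\mathcal{U}'$ are nearly coherent.
   Context: For a non-principal ultrafilter $\mathcal{U}$ on $\omega$, the ultrapower $\mathcal{U}\text{-prod}\,\omega$ is obtained from the set ${}^\omega\omega$ of all functions $f:\omega\to\omega$ by identifying $f$ and $g$ when $\{n: f(n)=g(n)\}\in\mathcal{U}$; it is linearly ordered by $f\leq_{\mathcal{U}} g \iff \{n: f(n)\leq g(n)\}\in\mathcal{U}$, and $\mathrm{cf}(\mathcal{U}\text{-prod}\,\omega)$ is the cofinality of this ordering (the least size of a $\leq_{\mathcal{U}}$-cofinal subset of ${}^\omega\omega$). The splitting number $\mathfrak{s}$ is the minimum size of a family $\mathcal{S}$ of subsets of $\omega$ such that every infinite $X\subseteq\omega$ is split by some $Y\in\mathcal{S}$, i.e., both $X\cap Y$ and $X\setminus Y$ are infinite. For $f:\omega\to\omega$, $f(\mathcal{U})=\{X\subseteq\omega: f^{-1}(X)\in\mathcal{U}\}$. Two ultrafilters $\mathcal{U},\mathcal{U}'$ are nearly coherent if there are finite-to-one functions $f,f':\omega\to\omega$ with $f(\mathcal{U})=f'(\mathcal{U}')$. *)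

(* Defs.v *)
From HB Require Import structures.
From mathcomp Require Import all_boot.
From mathcomp Require Import all_classical.
Set Implicit Arguments.
Unset Strict Implicit.
Unset Printing Implicit Defensive.
Local Open Scope classical_set_scope.
Local Open Scope card_scope.

(* Cardinal numbers are represented by sets of the given size, compared with *)
(* [#<=]. *)
Definition card_lt T U (A : set T) (B : set U) : Prop := A #<= B /\ ~ (B #<= A).

Notation "A '#<' B" := (card_lt A B)
  (at level 79, format "A  '#<'  B") : card_scope.

(* The least size of a member of [P], represented by a chosen member of [P]  *)
(* of that size. It exists as soon as [P] is nonempty, see [least_cardP].    *)
Definition least_card T (P : set (set T)) : set T :=
  xget set0 [set A | P A /\ forall B, P B -> A #<= B].

Lemma least_card_exists T (P : set (set T)) : P !=set0 ->
  exists A, P A /\ forall B, P B -> A #<= B.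
Proof.
move=> [A0 PA0].
have [P0|Pn0] := pselect (P set0); first by exists set0; split=> // B _.
have Pne B : P B -> exists x, B x.
  by move=> PB; apply/set0P; apply/negP => /eqP B0; apply: Pn0; rewrite -B0.
pose Q (R : set (set T -> T)) :=
  (forall g, R g -> forall B, P B -> B (g B)) /\
  (forall g h, R g -> R h -> forall B, P B -> g B = h B -> g = h).
have [F FQ Ftot|R [[RP Rinj] Rmax]] := @Zorn_bigcup _ Q.
  split=> [g [X FX Xg]|g h [X FX Xg] [Y FY Yh]]; first exact: (FQ X FX).1.
  have [XY|YX] := Ftot _ _ FX FY.
    by apply: (FQ Y FY).2 => //; exact: XY.
  by apply: (FQ X FX).2 => //; exact: YX.
have [B [PB RB]] : exists B, P B /\ forall x, B x -> exists2 g, R g & g B = x.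
  apply: contrapT => nB.
  have [g gP] : exists g : set T -> T, forall B, P B ->
      B (g B) /\ forall h, R h -> h B <> g B.
    have [x0 _] := Pne _ PA0.
    have : forall B, exists x, P B -> B x /\ forall h, R h -> h B <> x.
      move=> B; apply: contrapT => nx; apply: nB; exists B; split.
        by apply: contrapT => nPB; apply: nx; exists x0.
      move=> x Bx; apply: contrapT => ng; apply: nx; exists x => _; split=> //.
      by move=> h Rh hx; apply: ng; exists h.
    by move=> /choice[g gP]; exists g.
  apply: (Rmax (R `|` [set g])).
    split=> [|Rg]; first by move=> h; left.
    by have /(gP _ PA0).2/(_ erefl) : R g by apply: Rg; right.
  split=> [h [/RP//|-> C PC]|h k]; first exact: (gP _ PC).1.
  case=> [Rh|->] [Rk|->] C PC //.
  - exact: Rinj.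
  - by move/((gP _ PC).2 _ Rh).
  - by move/esym/((gP _ PC).2 _ Rk).
exists B; split=> // C PC.
have /choice[G GP] : forall x, exists g, B x -> R g /\ g B = x.
  move=> x; have [/RB[g Rg gx]|nBx] := pselect (B x); first by exists g.
  by exists (fun=> x) => /nBx.
have : $|{injfun B >-> C}|.
  apply/injfunPex; exists (fun x => G x C).
    by move=> x /GP[RG _]; apply: (RP _ RG).
  move=> x y /set_mem/GP[RGx Gx] /set_mem/GP[RGy Gy] /(Rinj _ _ RGx RGy _ PC) E.
  by rewrite -Gx -Gy E.
by case=> f; exact: inj_card_le f.
Qed.

Lemma least_cardP T (P : set (set T)) : P !=set0 ->
  P (least_card P) /\ forall B, P B -> least_card P #<= B.
Proof.
move=> /least_card_exists eP.
exact: (@xgetPex _ set0 [set A | P A /\ forall B, P B -> A #<= B] eP).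
Qed.

Definition nonprincipal_ultrafilter (U : set_system nat) : Prop :=
  UltraFilter U /\ forall n, U <> principal_filter n.

Definition leU (U : set_system nat) (f g : nat -> nat) : Prop :=
  U [set n | f n <= g n].

Definition cofinal_in_ultrapower (U : set_system nat) (D : set (nat -> nat)) :
    Prop :=
  forall f, exists2 g, D g & leU U f g.

Definition cf_ultrapower (U : set_system nat) : set (nat -> nat) :=
  least_card (cofinal_in_ultrapower U).

Definition split_by (X Y : set nat) : Prop :=
  infinite_set (X `&` Y) /\ infinite_set (X `\` Y).

Definition splitting_family (S : set (set nat)) : Prop :=
  forall X, infinite_set X -> exists2 Y, S Y & split_by X Y.

Definition splitting_number : set (set nat) := least_card splitting_family.

Lemma cf_ultrapowerP (U : set_system nat) : Filter U ->
  cofinal_in_ultrapower U (cf_ultrapower U) /\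
  forall D, cofinal_in_ultrapower U D -> cf_ultrapower U #<= D.
Proof.
move=> FU; apply: least_cardP; exists setT => f; exists f => //.
by apply: filterS filterT => n _ /=.
Qed.

Lemma splitting_numberP : splitting_family splitting_number /\
  forall S, splitting_family S -> splitting_number #<= S.
Proof.
apply: least_cardP; exists setT => X /infiniteP/pcard_leP[f].
have finj m n : f m = f n -> m = n by apply: inj; rewrite inE.
have fX n : X (f n) by exact: funS.
exists (range (fun n => f n.*2)) => //; split; apply/infiniteP/pcard_leP.
  apply/injfunPex; exists (fun n => f n.*2).
    by move=> n _; split=> //; exists n.
  by move=> m n _ _ /finj/double_inj.
apply/injfunPex; exists (fun n => f n.*2.+1).
  move=> n _; split=> // -[m _ /finj/(congr1 odd)].
  by rewrite /= !odd_double.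
by move=> m n _ _ /finj[/double_inj].
Qed.

Definition finite_to_one (f : nat -> nat) : Prop :=
  forall m, finite_set (f @^-1` [set m]).

Definition nearly_coherent (U U' : set_system nat) : Prop :=
  exists f f' : nat -> nat,
    [/\ finite_to_one f, finite_to_one f' & fmap f U = fmap f' U'].

(* Main.v *)
(* Suppose U and U' are not nearly coherent, and let D, D' be cofinal modulo *)
(* U and U'. For d in D and d' in D', put e = max(d, d'). Failure of near    *)
(* coherence gives A in U and A' in U' such that no interval [a, e(a)] with  *)
(* a in A meets an interval [a', e(a')] with a' in A'; let Y be the union of *)
(* the former. Given an infinite X, choose d and d' that dominate, modulo U  *)
(* and U', the map sending n to an element of X above n. Then X meets        *)
(* infinitely many of the intervals of both kinds, so Y splits X. Thus there *)
(* is a splitting family of size at most |D x D'| = max(|D|, |D'|).          *)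
Require Import Defs.
From mathcomp Require Import all_boot.
From mathcomp Require Import all_classical.
From mathcomp Require Import zify.
Set Implicit Arguments.
Unset Strict Implicit.
Unset Printing Implicit Defensive.
Local Open Scope classical_set_scope.
Local Open Scope card_scope.

(** The sets [A] and [A'] come from a finite-to-one [p] that grows by at most 1 along each interval
    [[a, e a]] ([finite_to_one_slow]). As [U] and [U'] are not nearly coherent, shifts of [p] send
    them to distinct ultrafilters, and sets telling these apart keep the values of [p] on [A] and on
    [A'] from being equal or adjacent ([not_nearly_coherent_intervals]). The size bound rests on
    [card_setX_infinite]: cofinal families are infinite, so the product of [D] and [D'] embeds in
    the larger of the two, which would then be at least as large as the splitting number. *)

(** * Comparison of cardinalities *)

Lemma card_le_comparable T (A B : set T) : A #<= B \/ B #<= A.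
Proof.
(* A set of least size among [A] and [B] embeds in the other. *)
have [|C [[->|->] CP]] := @least_card_exists T [set A; B].
- by exists A; left.
- by left; apply: CP; right.
- by right; apply: CP; left.
Qed.

Lemma card_le_inj T U (A : set T) (B : set U) (f : T -> U) :
  (forall x, A x -> B (f x)) -> {in A &, injective f} -> A #<= B.
Proof.
move=> fAB finj; have [] // : $|{injfun A >-> B}|; last first.
  by move=> g; exact: inj_card_le g.
by apply/injfunPex; exists f.
Qed.

Lemma card_leE T (U : pointedType) (A : set T) (B : set U) : A #<= B ->
  exists f : T -> U, (forall x, A x -> B (f x)) /\
    forall x y, A x -> A y -> f x = f y -> x = y.
Proof.
move=> /pcard_leP[f]; exists f; split=> [x Ax|x y Ax Ay]; first exact: funS.
by apply: inj; rewrite inE.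
Qed.

Lemma card_le_setX T T' (U U' : pointedType) (A : set T) (A' : set T')
    (B : set U) (B' : set U') :
  A #<= B -> A' #<= B' -> A `*` A' #<= B `*` B'.
Proof.
move=> /card_leE[f [fB finj]] /card_leE[f' [fB' finj']].
apply: (@card_le_inj _ _ _ _ (fun p => (f p.1, f' p.2))).
  by move=> [x x'] [/= /fB Bx /fB' Bx'].
move=> [x x'] [y y'] /set_mem[/= Ax Ax'] /set_mem[/= Ay Ay'].
by move=> [/(finj _ _ Ax Ay)-> /(finj' _ _ Ax' Ay')->].
Qed.

(** * Squares of infinite sets *)

Definition graph_field {T} (R : set ((T * T) * T)) : set T :=
  [set x | exists y, R ((x, x), y)].

(* [R] is the graph of an injection of the square of its field into it.      *)
Record square_injection {T} (R : set ((T * T) * T)) : Prop := SquareInjection {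
  square_field : forall x y z, R ((x, y), z) ->
    [/\ graph_field R x, graph_field R y & graph_field R z];
  square_total : forall x y, graph_field R x -> graph_field R y ->
    exists z, R ((x, y), z);
  square_fun : forall p z z', R (p, z) -> R (p, z') -> z = z';
  square_inj : forall p p' z, R (p, z) -> R (p', z) -> p = p' }.

(** Each clause assumes at most two triples or field points of the union, and these already occur in
    a single member of the chain. *)
Lemma square_injection_bigcup T (F : set (set ((T * T) * T))) :
  F `<=` square_injection -> total_on F subset ->
  square_injection (\bigcup_(X in F) X).
Proof.
move=> FQ Ftot.
have common X Y : F X -> F Y -> exists Z, [/\ F Z, X `<=` Z & Y `<=` Z].
  by move=> FX FY; have [XY|YX] := Ftot _ _ FX FY;
    [exists Y; split|exists X; split].
have fieldS X : F X ->
    graph_field X `<=` graph_field (\bigcup_(X in F) X).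
  by move=> FX x [y Xy]; exists y, X.
split.
- move=> x y z [X FX /(square_field (FQ _ FX))[? ? ?]].
  by split; apply: (fieldS X).
- move=> x y [x' [X FX Xx]] [y' [Y FY Yy]].
  have [Z [FZ XZ YZ]] := common _ _ FX FY.
  have [||z Zz] := @square_total _ _ (FQ _ FZ) x y.
  + by exists x'; exact: XZ.
  + by exists y'; exact: YZ.
  by exists z, Z.
- move=> p z z' [X FX Xx] [Y FY Yy].
  have [Z [FZ XZ YZ]] := common _ _ FX FY.
  exact: (square_fun (FQ _ FZ) (XZ _ Xx) (YZ _ Yy)).
- move=> p p' z [X FX Xx] [Y FY Yy].
  have [Z [FZ XZ YZ]] := common _ _ FX FY.
  exact: (square_inj (FQ _ FZ) (XZ _ Xx) (YZ _ Yy)).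
Qed.

Lemma square_injection_graph T (B : set T) (f : T * T -> T) :
  (forall x y, B x -> B y -> B (f (x, y))) ->
  {in B `*` B &, injective f} ->
  let R := [set q | (B `*` B) q.1 /\ q.2 = f q.1] in
  square_injection R /\ graph_field R = B.
Proof.
move=> fB finj R.
have RB : graph_field R = B.
  apply/seteqP; split=> [x [y [[]]]//|x Bx].
  by exists (f (x, x)).
split=> //; split; rewrite ?RB.
- by move=> x y z [[/= Bx By] ->]; split=> //; exact: fB.
- by move=> x y Bx By; exists (f (x, y)).
- by move=> p z z' [_ /= ->] [_ /= ->].
- by move=> p p' z [/= Bp ->] [/= Bp' /finj]; apply; apply/mem_set.
Qed.

Lemma square_injectionE (T : pointedType) (R : set ((T * T) * T)) :
  square_injection R -> exists f : T * T -> T,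
    [/\ forall x y, graph_field R x -> graph_field R y -> R ((x, y), f (x, y)),
    forall x y, graph_field R x -> graph_field R y -> graph_field R (f (x, y)) &
    forall p q, (graph_field R `*` graph_field R) p ->
      (graph_field R `*` graph_field R) q -> f p = f q -> p = q].
Proof.
move=> RQ.
have /choice[f fP] : forall p, exists z,
    (graph_field R `*` graph_field R) p -> R (p, z).
  move=> [x y].
  have [[Bx By]|nB] := pselect ((graph_field R `*` graph_field R) (x, y)).
    by have [z Rz] := square_total RQ Bx By; exists z.
  by exists point.
exists f; split.
- by move=> x y Bx By; exact: fP.
- move=> x y Bx By.
  by have [] := square_field RQ (fP (x, y) (conj Bx By)).
- move=> p q /fP Rp /fP + fpq; rewrite -fpq => Rq.
  exact: (square_inj RQ Rp Rq).
Qed.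

(* Two points [b0], [b1] of [B] tag the two halves of [B `|` C].             *)
Lemma absorb_injection T (B C : set T) (f : T * T -> T) (g : T -> T) :
  infinite_set B ->
  (forall x y, B x -> B y -> B (f (x, y))) ->
  (forall p q, (B `*` B) p -> (B `*` B) q -> f p = f q -> p = q) ->
  (forall x, C x -> B (g x)) ->
  (forall x y, C x -> C y -> g x = g y -> x = y) ->
  exists h : T -> T, (forall x, (B `|` C) x -> B (h x)) /\
    forall x y, (B `|` C) x -> (B `|` C) y -> h x = h y -> x = y.
Proof.
move=> Binf fB finj gB ginj.
have [b0 Bb0] : B !=set0 by exact: infinite_setN0.
have [b1 [Bb1 b10]] : (B `\` [set b0]) !=set0.
  by apply/infinite_setN0/infinite_setD.
exists (fun x => if x \in B then f (b0, x) else f (b1, g x)); split=> [x|x y].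
  by move=> [Bx|Cx]; case: ifPn => [/set_mem?|/negP xB]; apply: fB; auto;
    [case: xB; exact: mem_set].
move=> BCx BCy.
have nB z : (B `|` C) z -> z \notin B -> C z.
  by case=> // Bz /negP[]; exact: mem_set.
have pair_inj a b a' b' : B a -> B b -> B a' -> B b' ->
    f (a, b) = f (a', b') -> a = a' /\ b = b'.
  move=> Ba Bb Ba' Bb' E.
  by have [] := finj (a, b) (a', b') (conj Ba Bb) (conj Ba' Bb') E.
case: ifPn => [/set_mem Bx|/(nB _ BCx) Cx];
  case: ifPn => [/set_mem By|/(nB _ BCy) Cy] /pair_inj[]; auto.
- by move/esym/b10.
- by move/b10.
Qed.

(* The field of a maximal injection B * B -> B on infinite B has the size of *)
(* A, as otherwise A \ B contains a copy of B and the injection extends.     *)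
Lemma card_setX_infinite (T : pointedType) (A : set T) : infinite_set A ->
  A `*` A #<= A.
Proof.
move=> Ainf.
(* Infinitude is asked only of nonempty [R], so that the union of the empty chain satisfies [Q]. *)
pose Q (R : set ((T * T) * T)) := [/\ square_injection R, graph_field R `<=` A &
  R !=set0 -> infinite_set (graph_field R)].
have [F FQ Ftot|R [[RQ RA Rinf] Rmax]] := @Zorn_bigcup _ Q.
  split.
  - by apply: square_injection_bigcup => // X /FQ[].
  - by move=> x [y [X /FQ[_ XA _] Xx]]; apply: XA; exists y.
  - move=> [q [X FX Xq]]; have [_ _ /(_ (ex_intro _ q Xq))] := FQ _ FX.
    by apply: sub_infinite_set => x [y Xy]; exists y, X.
(* The empty graph is not maximal: a copy [u] of the naturals in [A], with the pairing [c], extends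
   it. *)
have {}Rinf : infinite_set (graph_field R).
  apply: Rinf; apply/set0P/negP => /eqP R0.
  have /infiniteP/card_leE[u [uA uinj]] := Ainf.
  have /card_leE[c [_ cinj]] : [set: nat * nat] #<= [set: nat].
    exact: countableP.
  have /choice[v vK] : forall x, exists n, range u x -> u n = x.
    move=> x; have [[n _ <-]|nx] := pselect (range u x); first by exists n.
    by exists 0.
  have [||Q0 Q0B] := @square_injection_graph T (range u)
    (fun p => u (c (v p.1, v p.2))).
  + by move=> x y _ _; exists (c (v x, v y)).
  + move=> [x y] [x' y'] /set_mem[/= /vK ux /vK uy].
    move=> /set_mem[/= /vK ux' /vK uy'].
    move=> /(uinj _ _ I I)/(cinj _ _ I I)[Ex Ey].
    by rewrite -ux -uy -ux' -uy' Ex Ey.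
  apply: (Rmax _ _ (And3 Q0 _ _)).
  + rewrite R0; split=> // /(_ ((u 0, u 0), u (c (v (u 0), v (u 0))))) [].
    by split=> //; split; exists 0.
  + by rewrite Q0B => _ [n _ <-]; exact: uA.
  + move=> _; rewrite Q0B; apply/infiniteP.
    apply: (@card_le_inj _ _ _ _ u) => [n _|m n _ _]; first by exists n.
    exact: uinj.
have [f [fR fB finj]] := square_injectionE RQ.
set B := graph_field R in RA Rinf fR fB finj *.
have [/card_leE[g [gB ginj]]|/card_leE[g [gA ginj]]] :=
    card_le_comparable (A `\` B) B.
  (* Here all of [A] embeds in [B], and [f] then brings its square into [B]. *)
  have [h [hB hinj]] := absorb_injection Rinf fB finj gB ginj.
  have AB x : A x -> (B `|` (A `\` B)) x.
    by move=> Ax; have [Bx|nBx] := pselect (B x); [left|right].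
  apply: (@card_le_inj _ _ _ _ (fun p => f (h p.1, h p.2))).
    by move=> [x y] [/= /AB/hB Bx /AB/hB By]; apply/RA/fB.
  move=> [x y] [x' y'] /set_mem[/= /AB Ax /AB Ay] /set_mem[/= /AB Ax' /AB Ay'].
  have hh u v : (B `|` (A `\` B)) u -> (B `|` (A `\` B)) v ->
    (B `*` B) (h u, h v) by move=> /hB Bu /hB Bv.
  move=> /(finj _ _ (hh _ _ Ax Ay) (hh _ _ Ax' Ay'))[Ex Ey].
  by rewrite (hinj _ _ Ax Ax' Ex) (hinj _ _ Ay Ay' Ey).
exfalso.
have /choice[v vK] : forall x, exists y, (g @` B) x -> B y /\ g y = x.
  move=> x; have [[n Bn <-]|nx] := pselect ((g @` B) x); first by exists n.
  by exists point.
have vinj x y : (g @` B) x -> (g @` B) y -> v x = v y -> x = y.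
  by move=> /vK[_ Ex] /vK[_ Ey] Exy; rewrite -Ex -Ey Exy.
have [h [hB hinj]] := absorb_injection Rinf fB finj
  (fun x gx => (vK x gx).1) vinj.
set D := B `|` g @` B in hB hinj.
have BD x : B x -> D x by left.
have gDB x : B x -> ~ B (g x) by move=> /gA[].
have gD x : B x -> D (g x) by move=> Bx; right; exists x.
(* [k] extends [f] to the square of [D]. New pairs go through [h] and [f] into [B], then through [g]
   out of [B], so they never collide with values of [f] on old pairs. *)
pose k p := if p \in B `*` B then f p else g (f (h p.1, h p.2)).
have kB p : (B `*` B) p -> k p = f p by move=> Bp; rewrite /k mem_set.
have knB p : ~ (B `*` B) p -> k p = g (f (h p.1, h p.2)).
  by move=> nBp; rewrite /k memNset.
have [||SQ SD] := @square_injection_graph T D k.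
- move=> x y Dx Dy; have [Bxy|nBxy] := pselect ((B `*` B) (x, y)).
    by rewrite kB//; case: Bxy => Bx By; apply/BD/fB.
  by rewrite knB//=; apply/gD/fB; exact: hB.
- move=> p q /set_mem[Dp1 Dp2] /set_mem[Dq1 Dq2].
  have kp (r : T * T) : D r.1 -> D r.2 -> B (f (h r.1, h r.2)).
    by move=> Dr1 Dr2; apply: fB; exact: hB.
  have fp (r : T * T) : (B `*` B) r -> B (f r).
    by case: r => r1 r2 [/= ? ?]; exact: fB.
  have [Bp|nBp] := pselect ((B `*` B) p);
    have [Bq|nBq] := pselect ((B `*` B) q).
  + by rewrite !kB//; exact: finj.
  + rewrite kB// knB// => E; case: (gDB (f (h q.1, h q.2))); first exact: kp.
    by rewrite -E; exact: fp.
  + rewrite knB// kB// => E; case: (gDB (f (h p.1, h p.2))); first exact: kp.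
    by rewrite E; exact: fp.
  + rewrite !knB// => /(ginj _ _ (kp _ Dp1 Dp2) (kp _ Dq1 Dq2)).
    have hh (r : T * T) : D r.1 -> D r.2 -> (B `*` B) (h r.1, h r.2).
      by move=> /hB Br1 /hB Br2.
    move=> /(finj _ _ (hh _ Dp1 Dp2) (hh _ Dq1 Dq2))[].
    move=> /(hinj _ _ Dp1 Dq1) E1 /(hinj _ _ Dp2 Dq2) E2.
    by rewrite [p]surjective_pairing [q]surjective_pairing E1 E2.
apply: (Rmax _ _ (And3 SQ _ _)).
- split=> [[[x y] z] Rxyz|].
    have [Bx By Bz] := square_field RQ Rxyz.
    split; first by split; exact: BD.
    by rewrite /= kB//; apply: (square_fun RQ Rxyz); exact: fR.
  have [b Bb] : B !=set0 by exact: infinite_setN0.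
  (* The extension is proper: [g b] lies outside the field of [R]. *)
  move=> SR; have Sgb : R ((g b, g b), k (g b, g b)).
    by apply: SR; split=> //; split; exact: gD.
  by have [Bgb _ _] := square_field RQ Sgb; exact: gDB Bb Bgb.
- by rewrite SD => x [/RA//|[y By <-]]; have [] := gA _ By.
- by move=> _; rewrite SD; apply: sub_infinite_set Rinf => x; exact: BD.
Qed.

(** * Infinite sets of naturals and ultrafilters *)

Lemma infinite_natP (A : set nat) :
  infinite_set A <-> forall N, exists2 n, N <= n & A n.
Proof.
split=> [Ainf N|Aunb /finite_seqP[s As]].
  apply: contrapT => nA; apply: Ainf.
  apply: sub_finite_set (finite_II N) => n An.
  by rewrite /= ltnNge; apply/negP => Nn; apply: nA; exists n.
(* The sum of a list bounds each of its entries. *)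
have [n] := Aunb (\sum_(i <- s) i).+1.
by rewrite ltnNge As => /negP nle ns; apply: nle; rewrite (big_rem n) ?leq_addr.
Qed.

(** An ultrafilter containing a singleton is principal, so points can be removed from a tail one at
    a time. *)
Lemma nonprincipal_ge (U : set_system nat) : nonprincipal_ultrafilter U ->
  forall N, U [set n | N <= n].
Proof.
move=> [UU Unp]; elim=> [|N IHN]; first exact: filterS filterT.
have UN : U [set~ N].
  have [UN|//] := in_ultra_setVsetC [set N] UU.
  case: (Unp N); apply/seteqP; split=> [B UB|B /principal_filterP BN].
    apply/principal_filterP; have [n [Bn <-//]] : (B `&` [set N]) !=set0.
    by apply: (@filter_ex _ U); exact: filterI.
  by apply: filterS UN => _ ->.
apply: filterS (filterI IHN UN) => n [/= Nn /eqP nN].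
by rewrite ltn_neqAle eq_sym nN.
Qed.

(** * Separation without near coherence *)

Lemma finite_to_oneD f j : finite_to_one f -> finite_to_one (fun n => f n + j).
Proof.
move=> ff m; apply: sub_finite_set (ff (m - j)) => n /= <-.
by rewrite addnK.
Qed.

(* [p n] is the least [k] with [n <= x k], where [x] iterates a monotone     *)
(* strictly inflationary bound [E] of [e].                                   *)
Lemma finite_to_one_slow (e : nat -> nat) : exists p : nat -> nat,
  [/\ finite_to_one p, {homo p : m n / m <= n} &
      forall m n, n <= e m -> p n <= (p m).+1].
Proof.
pose E n := n.+1 + \sum_(i < n.+1) e i.
have Emono m n : m <= n -> E m <= E n.
  move=> mn; apply: leq_add; first by rewrite ltnS.
  rewrite -(subnKC mn) -addSn big_split_ord /=; exact: leq_addr.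
have Ee n : e n <= E n.
  by rewrite /E big_ord_recr /= addnA leq_addl.
pose x k := iter k E 0.
have xge k : k <= x k.
  elim: k => // k IHk; apply: leq_ltn_trans IHk _.
  by rewrite /= /E addSn ltnS leq_addr.
have xex n : exists k, n <= x k by exists n.
pose p n := ex_minn (xex n).
have px n : n <= x (p n) by rewrite /p; case: ex_minnP.
have pmin n k : n <= x k -> p n <= k.
  by rewrite /p; case: ex_minnP => q _; apply.
exists p; split.
- move=> k; apply: sub_finite_set (finite_II (x k).+1) => n /= <-.
  by rewrite ltnS.
- by move=> m n mn; apply/pmin/(leq_trans mn).
(* [n <= e m <= E m <= E (x (p m)) = x (p m).+1]. *)
- move=> m n nem; apply: pmin; rewrite /= (leq_trans nem)//.
  exact: leq_trans (Ee m) (Emono _ _ (px m)).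
Qed.

(** If no [Z] separates, then, since an ultrafilter contains each set or its complement, the images
    under [f] and [f'] coincide. *)
Lemma not_nearly_coherent_separation (U U' : set_system nat) f f' :
  UltraFilter U -> UltraFilter U' -> ~ nearly_coherent U U' ->
  finite_to_one f -> finite_to_one f' ->
  exists Z, U (f @^-1` Z) /\ U' (f' @^-1` (~` Z)).
Proof.
move=> UU UU' nc ff ff'; apply: contrapT => nZ; apply: nc; exists f, f'.
split=> //; apply/seteqP; split=> Z /= UZ.
  have [//|nUZ] := in_ultra_setVsetC (f' @^-1` Z) UU'.
  by case: nZ; exists Z.
have [//|nUZ] := in_ultra_setVsetC (f @^-1` Z) UU.
by case: nZ; exists (~` Z); rewrite setCK.
Qed.

Lemma not_nearly_coherent_intervals (U U' : set_system nat) (e : nat -> nat) :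
  UltraFilter U -> UltraFilter U' -> ~ nearly_coherent U U' ->
  exists A A' : set nat, [/\ U A, U' A' & forall a a' m, A a -> A' a' ->
    a <= m <= e a -> ~ a' <= m <= e a'].
Proof.
move=> UU UU' nc; have [p [pf pmono pe]] := finite_to_one_slow e.
have sep i j := not_nearly_coherent_separation UU UU' nc
  (finite_to_oneD i pf) (finite_to_oneD j pf).
have [Z0 [UZ0 UZ0']] := sep 0 0.
have [Z1 [UZ1 UZ1']] := sep 1 0.
have [Z2 [UZ2 UZ2']] := sep 0 1.
(* The three shifts make the values of [p] on [A] and [A'] differ by at least *)
(* 2, whereas [p] grows by at most 1 along each interval.                    *)
eexists; eexists; split.
- exact: filterI UZ0 (filterI UZ1 UZ2).
- exact: filterI UZ0' (filterI UZ1' UZ2').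
move=> a a' m [/= Z0a [Z1a Z2a]] [/= Z0a' [Z1a' Z2a']].
move=> /andP[am me] /andP[am' me'].
(* A common point [m] puts both [p a] and [p a'] among [p m] and its predecessor. *)
have pa : p a <= p m <= (p a).+1 by rewrite pmono// pe.
have pa' : p a' <= p m <= (p a').+1 by rewrite pmono// pe.
have : [|| p a == p a', p a + 1 == p a' | p a == p a' + 1] by lia.
case/or3P => /eqP E.
- by apply: Z0a'; rewrite -E.
- by apply: Z1a'; rewrite addn0 -E.
- by apply: Z2a'; rewrite -E -[p a]addn0.
Qed.

(** * The splitting family *)

(** The sum of finitely many functions, plus one, exceeds each of them everywhere. *)
Lemma cofinal_infinite (U : set_system nat) (D : set (nat -> nat)) :
  ProperFilter U -> cofinal_in_ultrapower U D -> infinite_set D.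
Proof.
move=> UU Dcof /finite_seqP[s Ds].
have [d] := Dcof (fun n => (\sum_(g <- s) g n).+1).
rewrite Ds => ds /filter_ex[n] /=; rewrite ltnNge => /negP[].
by rewrite (big_rem d) ?leq_addr.
Qed.

Theorem theorem9 (U U' : set_system nat)
    (hU : nonprincipal_ultrafilter U) (hU' : nonprincipal_ultrafilter U')
    (hcf : cf_ultrapower U #< splitting_number)
    (hcf' : cf_ultrapower U' #< splitting_number) :
  nearly_coherent U U'.
Proof.
apply: contrapT => nc.
have UU : UltraFilter U := hU.1.
have UU' : UltraFilter U' := hU'.1.
have [Dcof _] := cf_ultrapowerP (U := U) _.
have [D'cof _] := cf_ultrapowerP (U := U') _.
set D := cf_ultrapower U in hcf Dcof.
set D' := cf_ultrapower U' in hcf' D'cof.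
have [A AP] := choice (fun e => not_nearly_coherent_intervals e UU UU' nc).
have {AP}[A' AP] := choice AP.
(* The separation uses one [e] for both kinds of intervals; the maximum serves [d.1] and [d.2]
   alike. *)
pose e (d : (nat -> nat) * (nat -> nat)) n := maxn (d.1 n) (d.2 n).
pose Y d := [set m | exists2 a, A (e d) a & a <= m <= e d a].
have Ysplit : splitting_family (Y @` (D `*` D')).
  move=> X /infinite_natP Xinf.
  have /choice[s sP] : forall n, exists m, n <= m /\ X m.
    by move=> n; have [m] := Xinf n; exists m.
  have [d Dd sd] := Dcof s.
  have [d' Dd' sd'] := D'cof s.
  exists (Y (d, d')); first by exists (d, d').
  have [UA UA' AA'] := AP (e (d, d')).
  split; apply/infinite_natP => N.
    (* Since [n <= s n <= d n], the point [s n] of [X] lies in the interval starting at [n]. *)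
    have [n [[/= Nn snd] An]] :=
      filter_ex (filterI (filterI (nonprincipal_ge hU N) sd) UA).
    have [ns Xs] := sP n; exists (s n); first exact: leq_trans ns.
    by split=> //; exists n => //; rewrite ns /e /= leq_max snd.
  (* Now [s n] lies in an interval starting in [A'], hence in none that makes up [Y]. *)
  have [n [[/= Nn snd] An]] :=
    filter_ex (filterI (filterI (nonprincipal_ge hU' N) sd') UA').
  have [ns Xs] := sP n; exists (s n); first exact: leq_trans ns.
  split=> // -[a Aa asn]; apply: AA' Aa An asn _.
  by rewrite ns /e /= leq_max snd orbT.
have sDD' : splitting_number #<= D `*` D'.
  exact: card_le_trans (splitting_numberP.2 _ Ysplit) (card_image_le _ _).
have squareP (C : set (nat -> nat)) : infinite_set C -> D #<= C -> D' #<= C ->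
    splitting_number #<= C.
  move=> Cinf DC D'C; apply: card_le_trans sDD' _.
  apply: card_le_trans (card_setX_infinite Cinf).
  exact: card_le_setX.
have [DD'|D'D] := card_le_comparable D D'.
  by apply: hcf'.2; apply: squareP => //; exact: cofinal_infinite D'cof.
by apply: hcf.2; apply: squareP => //; exact: cofinal_infinite Dcof.
Qed.
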